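(* Consider a rigid body (moving plane) in planar motion, and an instant at which its angular velocity $\omega$ is nonzero; let $P$ be its velocity pole. Let $k>1$ and suppose $\Omega_r^{(k)}\ne0$ and $\Omega_t^{(k)}\neq 0$ at that instant. Then the locus of points of the moving plane that have no normal acceleration of order $k$ is a circle (the zero normal circle, or first Bresse circle of order $k-1$), and the locus of points that have no tangential acceleration of order $k$ is a circle (the zero tangential circle, or second Bresse circle of order $k-1$). Both circles pass through $P$, and their diameter vectors from $P$ to the opposite points $N_{k-1}$ and $T_{k-1}$ on them are, respectively, $$\mathbf r_{PN_{k-1}}=\frac{\mathbf p^{(k)}}{\Omega_r^{(k)}},\qquad \mathbf r_{PT_{k-1}}=\frac{\tilde{\mathbf p}^{(k)}}{\Omega_t^{(k)}}.$$ The two diameter vectors are perpendicular to each other, and the circles are kinematic invariants, i.e. they do not depend on the choice of the body point $A$ used to describe the motion.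
   Context: $\mathbf J=\begin{pmatrix}0&-1\\1&0\end{pmatrix}$ and $\tilde{\mathbf a}=\mathbf J\mathbf a$ for $\mathbf a\in\mathbb R^2$; $\mathbf a\mathbf b$ (or $\mathbf a\cdot\mathbf b$) is the standard scalar product. $\mathbf r_{AB}=\mathbf r_B-\mathbf r_A$. Rigid body with angular velocity $\omega$: $\dot{\mathbf r}_{AB}=\omega\,\tilde{\mathbf r}_{AB}$ for all pairs of points $A,B$ fixed to the moving plane. All functions are sufficiently often differentiable. The velocity pole $P$ is the point of the moving plane whose velocity vanishes at the instant considered, so that every body point $Q$ has velocity $\mathbf v_Q=\omega\,\tilde{\mathbf r}_{PQ}$. The scalars $\Omega_r^{(k)},\Omega_t^{(k)}$ are defined by $\Omega_r^{(0)}=-1$, $\Omega_t^{(0)}=0$, $\Omega_r^{(k+1)}=\dot\Omega_r^{(k)}+\omega\,\Omega_t^{(k)}$, $\Omega_t^{(k+1)}=\dot\Omega_t^{(k)}-\omega\,\Omega_r^{(k)}$ (superscript an index, dot a time derivative). $\mathbf r_Q^{(k)}$ is the $k$-th time derivative of the position of body point $Q$ (acceleration of order $k$). $\mathbf p^{(k)}$ is the acceleration of order $k$ of the body point that instantaneously coincides with $P$; in terms of any body point $A$, $\mathbf p^{(k)}=\mathbf r_A^{(k)}-\Omega_r^{(k)}\mathbf r_{AP}+\Omega_t^{(k)}\tilde{\mathbf r}_{AP}$, and $\tilde{\mathbf p}^{(k)}=\mathbf J\mathbf p^{(k)}$. A body point $Q$ is said to have no tangential acceleration of order $k$ if $\mathbf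 v_Q\cdot\mathbf r_Q^{(k)}=0$, and no normal acceleration of order $k$ if $\tilde{\mathbf v}_Q\cdot\mathbf r_Q^{(k)}=0$ (so $P$ itself satisfies both). The circle through $P$ with diameter vector $\mathbf d$ starting at $P$ is the set of points $Q$ with $\mathbf r_{PQ}\cdot\mathbf r_{PQ}-\mathbf d\cdot\mathbf r_{PQ}=0$; it degenerates to the point $P$ if $\mathbf d=\mathbf 0$. *)

(* Defs.v *)
From HB Require Import structures.
From mathcomp Require Import all_boot all_order all_algebra.
From mathcomp Require Import all_classical all_reals all_analysis.
Set Implicit Arguments.
Unset Strict Implicit.
Unset Printing Implicit Defensive.
Import Order.TTheory GRing.Theory Num.Theory.
Import numFieldNormedType.Exports.
Local Open Scope classical_set_scope.
Local Open Scope ring_scope.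

Notation plane R := 'cV[R]_2.

Definition Jmx (R : realType) : 'M[R]_2 := delta_mx 1 0 - delta_mx 0 1.

Definition tilde (R : realType) (a : plane R) : plane R := Jmx R *m a.

Definition dot (R : realType) (a b : plane R) : R := \sum_i a i 0 * b i 0.

(* The circle through c with diameter vector d starting at c. *)
Definition circle (R : realType) (c d : plane R) : set (plane R) :=
  [set q | dot (q - c) (q - c) - dot d (q - c) = 0].

Definition n_derivable (R : realType) (V : normedModType R) (I : set R)
    (n : nat) (f : R -> V) : Prop :=
  forall j t, (j < n)%N -> I t -> derivable (derive1n j f) t 1.

Definition direct_isometry (R : realType) (f : plane R -> plane R) : Prop :=
  exists (M : 'M[R]_2) (c : plane R),
    [/\ M^T *m M = 1%:M, \det M = 1 & forall X, f X = M *m X + c].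

(* Body points are named by their coordinates in a frame fixed to the moving
   plane; r A t is the position of the body point A in the fixed plane at time
   t, and w is the angular velocity. *)
Definition rigid_motion (R : realType) (I : set R)
    (r : plane R -> R -> plane R) (w : R -> R) : Prop :=
  forall t, I t ->
    direct_isometry (fun A => r A t) /\
    forall A B, is_derive t 1 (fun s => r B s - r A s)
                  (w t *: tilde (r B t - r A t)).

Definition accel (R : realType) (r : plane R -> R -> plane R) (k : nat)
    (Q : plane R) (t : R) : plane R := derive1n k (r Q) t.

Definition velocity (R : realType) (r : plane R -> R -> plane R)
    (Q : plane R) (t : R) : plane R := derive1 (r Q) t.

Definition velocity_pole (R : realType) (r : plane R -> R -> plane R)
    (t : R) (P : plane R) : Prop := velocity r P t = 0.

Fixpoint Omega (R : realType) (w : R -> R) (k : nat) : (R -> R) * (R -> R) :=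
  if k is k'.+1 then
    let Or := (Omega w k').1 in
    let Ot := (Omega w k').2 in
    (fun t => derive1 Or t + w t * Ot t, fun t => derive1 Ot t - w t * Or t)
  else (fun=> -1, fun=> 0).

Definition Omega_r (R : realType) (w : R -> R) (k : nat) (t : R) : R :=
  (Omega w k).1 t.

Definition Omega_t (R : realType) (w : R -> R) (k : nat) (t : R) : R :=
  (Omega w k).2 t.

(* The acceleration of order k of the body point P, computed from the motion of
   the body point A. *)
Definition accel_via (R : realType) (r : plane R -> R -> plane R)
    (w : R -> R) (k : nat) (P : plane R) (t : R) (A : plane R) : plane R :=
  accel r k A t - Omega_r w k t *: (r P t - r A t)
    + Omega_t w k t *: tilde (r P t - r A t).

Definition no_tangential (R : realType) (r : plane R -> R -> plane R)
    (k : nat) (t : R) (Q : plane R) : Prop :=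
  dot (velocity r Q t) (accel r k Q t) = 0.

Definition no_normal (R : realType) (r : plane R -> R -> plane R)
    (k : nat) (t : R) (Q : plane R) : Prop :=
  dot (tilde (velocity r Q t)) (accel r k Q t) = 0.

(* Positions at time t, in the fixed plane, of the body points in S. *)
Definition locus (R : realType) (r : plane R -> R -> plane R) (t : R)
    (S : set (plane R)) : set (plane R) := (fun Q => r Q t) @` S.

Definition normal_circle_via (R : realType) (r : plane R -> R -> plane R)
    (w : R -> R) (k : nat) (P : plane R) (t : R) (A : plane R) :=
  circle (r P t) ((Omega_r w k t)^-1 *: accel_via r w k P t A).

Definition tangential_circle_via (R : realType) (r : plane R -> R -> plane R)
    (w : R -> R) (k : nat) (P : plane R) (t : R) (A : plane R) :=
  circle (r P t) ((Omega_t w k t)^-1 *: tilde (accel_via r w k P t A)).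

(* Main.v *)
(* Since J^2 = -1, differentiating d' = w Jd repeatedly gives
   d^(k) = - Or d + Ot Jd for the difference d of any two body points, where Or
   and Ot are Omega_r and Omega_t of order k. For d = r_AP this says that
   accel_via does not depend on A; for x = r_PQ, together with v_Q = w Jx and
   x . Jx = 0, it gives
     Jv_Q . r_Q^(k) = w (Or x . x - p . x)
      v_Q . r_Q^(k) = w (Ot x . x - Jp . x),
   which are the equations of the two circles up to the factors w Or and
   w Ot. *)

Require Import Defs.
From HB Require Import structures.
From mathcomp Require Import all_boot all_order all_algebra.
From mathcomp Require Import all_classical all_reals all_analysis.
From mathcomp Require Import ring.
Set Implicit Arguments.
Unset Strict Implicit.
Unset Printing Implicit Defensive.
Import Order.TTheory GRing.Theory Num.Theory.
Import numFieldNormedType.Exports.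
Local Open Scope classical_set_scope.
Local Open Scope ring_scope.

(** * Functions with finitely many derivatives on an open set *)

Section HigherDerivatives.
Variables (R : realType) (I : set R).
Hypothesis openI : open I.

(** [derive1n] unfolds at the outermost derivative; splitting off the innermost one instead allows
    induction on [n] for all functions at once. *)
Lemma n_derivableS (V : normedModType R) n (f : R -> V) :
  n_derivable I n.+1 f <->
  (forall t, I t -> derivable f t 1) /\ n_derivable I n (derive1 f).
Proof.
split=> [df|[df0 df] [|j] t jn It]; last by rewrite derive1Sn; apply: df.
  by split=> [t|j t jn] It; [apply: (df 0%N)|rewrite -derive1Sn; apply: df].
exact: df0.
Qed.

Lemma n_derivableW (V : normedModType R) m n (f : R -> V) :
  (m <= n)%N -> n_derivable I n f -> n_derivable I m f.
Proof. by move=> mn df j t jm; apply/df/(leq_trans jm). Qed.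

(** An open [I] is a neighbourhood of each of its points, and derivatives see only values nearby. *)
Lemma near_open_eq (V : Type) (f g : R -> V) :
  (forall t, I t -> f t = g t) -> forall t, I t -> \near t, f t = g t.
Proof.
by move=> fg t It; near=> s; apply: fg; near: s; apply: open_nbhs_nbhs.
Unshelve. all: by end_near. Qed.

Lemma eq_n_derivable (V : normedModType R) n (f g : R -> V) :
  (forall t, I t -> f t = g t) -> n_derivable I n f -> n_derivable I n g.
Proof.
elim: n f g => // n IHn f g fg /n_derivableS[df dnf]; apply/n_derivableS.
split=> [t It|].
  exact: near_eq_derivable (near_open_eq fg It) (df t It).
apply: IHn dnf => t It; rewrite !derive1E.
exact: near_eq_derive (near_open_eq fg It).
Qed.

Lemma n_derivable_cst (V : normedModType R) n (c : V) :
  n_derivable I n (fun=> c).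
Proof.
elim: n c => // n IHn c; apply/n_derivableS; split=> [t It|].
  exact: derivable_cst.
by apply: eq_n_derivable (IHn 0) => t It; rewrite derive1_cst.
Qed.

Lemma n_derivableD (V : normedModType R) n (f g : R -> V) :
  n_derivable I n f -> n_derivable I n g ->
  n_derivable I n (fun t => f t + g t).
Proof.
elim: n f g => // n IHn f g /n_derivableS[df dnf] /n_derivableS[dg dng].
apply/n_derivableS; split=> [t It|].
  by apply: derivableD; [apply: df|apply: dg].
apply: eq_n_derivable (IHn _ _ dnf dng) => t It.
by rewrite !derive1E; apply/esym/deriveD; [apply: df|apply: dg].
Qed.

Lemma n_derivableN (V : normedModType R) n (f : R -> V) :
  n_derivable I n f -> n_derivable I n (fun t => - f t).
Proof.
elim: n f => // n IHn f /n_derivableS[df dnf].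
apply/n_derivableS; split=> [t It|]; first by apply: derivableN; apply: df.
apply: eq_n_derivable (IHn _ dnf) => t It.
by rewrite !derive1E; apply/esym/deriveN; apply: df.
Qed.

Lemma n_derivableM n (f g : R -> R) :
  n_derivable I n f -> n_derivable I n g ->
  n_derivable I n (fun t => f t * g t).
Proof.
elim: n f g => [|n IHn] f g df dg; first by move=> j t; rewrite ltn0.
have [df1 df'] := (n_derivableS n f).1 df.
have [dg1 dg'] := (n_derivableS n g).1 dg.
apply/n_derivableS; split=> [t It|].
  exact: derivableM (df1 t It) (dg1 t It).
have dfg' := IHn _ _ (n_derivableW (leqnSn n) df) dg'.
have df'g := IHn _ _ (n_derivableW (leqnSn n) dg) df'.
apply: eq_n_derivable (n_derivableD dfg' df'g) => t It.
rewrite !derive1E; exact: esym (deriveM (df1 t It) (dg1 t It)).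
Qed.

(** Order 0 is constant and order 1 contains [w] undifferentiated, so order [j] involves at most
    [j - 1] derivatives of [w]; hence the count [n.+1 - j]. *)
Lemma Omega_n_derivable w n j : n_derivable I n w -> (j <= n.+1)%N ->
  n_derivable I (n.+1 - j) (Omega w j).1 /\
  n_derivable I (n.+1 - j) (Omega w j).2.
Proof.
move=> dw; elim: j => [|j IHj] jn; first by split; apply: n_derivable_cst.
(* Of the [(n - j).+1] available derivatives one is spent on the recursion; the products with [w]
   need only [n - j]. *)
have [] := IHj (ltnW jn); rewrite subSS subSn //.
move=> /[dup] dr /n_derivableS[_ dr'] /[dup] dt /n_derivableS[_ dt'].
have {}dr := n_derivableW (leqnSn _) dr.
have {}dt := n_derivableW (leqnSn _) dt.
have {}dw : n_derivable I (n - j) w by apply: n_derivableW dw; apply: leq_subr.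
split; first exact: n_derivableD dr' (n_derivableM dw dt).
exact: n_derivableD dt' (n_derivableN (n_derivableM dw dr)).
Qed.

End HigherDerivatives.

(** * Derivatives of matrix-valued functions, taken entrywise *)

Section DeriveMx.
Variables (R : realType) (m n : nat).
Implicit Types (M : R -> 'M[R]_(m, n)).

Lemma is_derive_mxP M (t v : R) (D : 'M[R]_(m, n)) :
  is_derive t v M D <->
  forall i j, is_derive t v (fun s => M s i j) (D i j).
Proof.
split=> [[dM <-] i j|dM].
  by apply: DeriveDef; [apply: (derivable_mxP M t v).1|rewrite derive_mx// mxE].
have dM' : derivable M t v.
  by apply/derivable_mxP => i j; have [] := dM i j.
apply: DeriveDef => //; rewrite derive_mx//; apply/matrixP=> i j.
by rewrite mxE; have [] := dM i j.
Qed.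

Lemma is_derive_scale_mx (a : R -> R) M (t v a' : R) (D : 'M[R]_(m, n)) :
  is_derive t v a a' -> is_derive t v M D ->
  is_derive t v (fun s => a s *: M s) (a t *: D + a' *: M t).
Proof.
move=> da /is_derive_mxP dM; apply/is_derive_mxP => i j.
under eq_fun do rewrite mxE.
have := is_deriveM da (dM i j).
by rewrite !mxE [a' * _]mulrC.
Qed.

End DeriveMx.

Lemma is_derive_mulmx (R : realType) (m n p : nat) (A : 'M[R]_(p, m))
    (M : R -> 'M[R]_(m, n)) (t v : R) (D : 'M[R]_(m, n)) :
  is_derive t v M D -> is_derive t v (fun s => A *m M s) (A *m D).
Proof.
move=> /is_derive_mxP dM; apply/is_derive_mxP => i j.
under eq_fun do rewrite mxE; rewrite mxE.
have -> : (fun s => \sum_l A i l * M s l j) =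
          \sum_l (A i l \*: (fun s => M s l j)).
  by apply/funext => s; rewrite fct_sumE.
by apply: is_derive_sum => l; apply: is_deriveZ.
Qed.

(** * Plane vectors, circles and isometries *)

Section Plane.
Variable R : realType.
Implicit Types (a b : plane R).

Lemma plane_eq a b : a 0 0 = b 0 0 -> a 1 0 = b 1 0 -> a = b.
Proof.
move=> ab0 ab1; apply/colP => -[[|[|//]] lti2].
  by have -> : Ordinal lti2 = 0 by apply/val_inj.
by have -> : Ordinal lti2 = 1 by apply/val_inj.
Qed.

Lemma sum_ord2 (F : 'I_2 -> R) : \sum_i F i = F 0 + F 1.
Proof.
rewrite big_ord_recl big_ord1.
by have -> : lift ord0 ord0 = 1 :> 'I_2 by apply/val_inj.
Qed.

Lemma dotE a b : dot a b = a 0 0 * b 0 0 + a 1 0 * b 1 0.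
Proof. exact: sum_ord2. Qed.

Lemma tilde0 a : tilde a 0 0 = - a 1 0.
Proof. by rewrite mxE sum_ord2 !mxE /=; ring. Qed.

Lemma tilde1 a : tilde a 1 0 = a 0 0.
Proof. by rewrite mxE sum_ord2 !mxE /=; ring. Qed.

Lemma tildeK a : tilde (tilde a) = - a.
Proof. by apply: plane_eq; rewrite ?(tilde0, tilde1) mxE. Qed.

(** The first factor is [- w *: x], which is orthogonal to [tilde x], so the [Ot] term drops out. *)
Lemma dot_normal (w Or Ot : R) (p x : plane R) :
  dot (tilde (w *: tilde x)) (p - Or *: x + Ot *: tilde x) =
  w * (Or * dot x x - dot p x).
Proof. by rewrite !(dotE, tilde0, tilde1, mxE); ring. Qed.

(** Here the [Or] term drops out; J preserves scalar products and is skew, which moves the tilde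
    onto [p] with a minus sign. *)
Lemma dot_tangential (w Or Ot : R) (p x : plane R) :
  dot (w *: tilde x) (p - Or *: x + Ot *: tilde x) =
  w * (Ot * dot x x - dot (tilde p) x).
Proof. by rewrite !(dotE, tilde0, tilde1, mxE); ring. Qed.

Lemma circle_start (c d : plane R) : circle c d c.
Proof. by rewrite /circle /= subrr !dotE !mxE; ring. Qed.

Lemma circle_opposite (c d : plane R) : circle c d (c + d).
Proof. by rewrite /circle /= [c + d]addrC addrK subrr. Qed.

Lemma mem_circle_scale (c p q : plane R) (k : R) : k != 0 ->
  circle c (k^-1 *: p) q = (k * dot (q - c) (q - c) - dot p (q - c) = 0).
Proof.
move=> k0; rewrite /circle /= !dotE !mxE; apply/propext; split=> h.
  have := congr1 (fun z => k * z) h; rewrite mulr0 => <-; field; exact: k0.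
have := congr1 (fun z => k^-1 * z) h; rewrite mulr0 => <-; field; exact: k0.
Qed.

(** For a square matrix the left inverse [M^T] is also a right inverse. Thus every point of the
    fixed plane is occupied by a body point. *)
Lemma direct_isometry_surj (f : plane R -> plane R) (y : plane R) :
  direct_isometry f -> exists x, f x = y.
Proof.
move=> [M [c [/mulmx1C MMT _ fE]]]; exists (M^T *m (y - c)).
by rewrite fE mulmxA MMT mul1mx subrK.
Qed.

End Plane.

(** * Relative accelerations of two body points *)

Section RigidMotion.
Variables (R : realType) (I : set R) (r : plane R -> R -> plane R) (w : R -> R).
Hypotheses (openI : open I) (motion : rigid_motion I r w).

Lemma accelB (n : nat) (A B : plane R) :
  (forall Q, n_derivable I n.+1 (r Q)) -> n_derivable I n w ->
  forall j t, (j <= n.+1)%N -> I t ->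
  accel r j B t - accel r j A t =
    - Omega_r w j t *: (r B t - r A t) + Omega_t w j t *: tilde (r B t - r A t).
Proof.
move=> dr dw; elim=> [|j IHj] t jn It.
  (* The initial values -1 and 0 make the right-hand side the difference itself. *)
  by rewrite /accel /Omega_r /Omega_t /= opprK scale1r scale0r addr0.
have [dOr dOt] := Omega_n_derivable openI dw (ltnW jn).
have jn0 : (0 < n.+1 - j)%N by rewrite subn_gt0.
have := dOr 0%N t jn0 It; have := dOt 0%N t jn0 It; rewrite !derive1n0.
move=> /derivableP {}dOt /derivableP {}dOr.
have dAB := (motion It).2 A B.
have dtAB := is_derive_mulmx (Jmx R) dAB.
have dR : is_derive t 1 (fun s => accel r j B s - accel r j A s)
    (accel r j.+1 B t - accel r j.+1 A t).
  rewrite /accel !derive1nS !derive1E.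
  by apply: is_deriveB; apply: derivableP; apply: dr.
have dL := is_deriveD (is_derive_scale_mx (is_deriveN dOr) dAB)
                      (is_derive_scale_mx dOt dtAB).
(* The identity of order [j] holds throughout [I], hence near [t], so its two sides have equal
   derivatives at [t]. *)
have /(near_open_eq openI)/(_ t It) nLR := fun s => IHj s (ltnW jn).
have [_ <-] := near_eq_is_derive nLR dR; have [_ ->] := dL.
rewrite /Omega_r /Omega_t /= !derive1E.
rewrite -/(tilde (r B t - r A t)) -/(tilde (w t *: tilde (r B t - r A t))).
set x := r B t - r A t.
have -> : tilde (w t *: tilde x) = - w t *: x.
  rewrite /tilde linearZ /= -/(tilde x) -/(tilde (tilde x)) tildeK.
  by rewrite scalerN scaleNr.
(* Grouping by the difference and its tilde yields exactly the recursion for the two Omegas. *)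
have collect (a b a' b' c : R) (y z : plane R) :
    - a *: (c *: z) + - a' *: y + (b *: (- c *: y) + b' *: z) =
    - (a' + c * b) *: y + (b' - c * a) *: z.
  by apply: plane_eq; rewrite !mxE; ring.
exact: collect.
Qed.

Lemma velocityB (A B : plane R) t :
  (forall Q, derivable (r Q) t 1) -> I t ->
  velocity r B t - velocity r A t = w t *: tilde (r B t - r A t).
Proof.
move=> dr It; have [_ <-] := (motion It).2 A B.
by rewrite /velocity !derive1E; apply/esym/deriveB; apply: dr.
Qed.

End RigidMotion.

(** * The two loci, seen from the velocity pole *)

Theorem theorem6p1 (R : realType) (I : set R) (r : plane R -> R -> plane R)
    (w : R -> R) (t0 : R) (P : plane R) (k : nat)
    (openI : open I) (It0 : I t0)
    (k_gt1 : (1 < k)%N)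
    (r_diff : forall A, n_derivable I k (r A))
    (w_diff : n_derivable I k.-1 w)
    (motion : rigid_motion I r w)
    (w_neq0 : w t0 != 0)
    (poleP : velocity_pole r t0 P)
    (Or_neq0 : Omega_r w k t0 != 0)
    (Ot_neq0 : Omega_t w k t0 != 0) :
  let p := accel r k P t0 in
  let zero_normal := locus r t0 [set Q | no_normal r k t0 Q] in
  let zero_tangential := locus r t0 [set Q | no_tangential r k t0 Q] in
  (exists N T : plane R,
    let r_PN := r N t0 - r P t0 in
    let r_PT := r T t0 - r P t0 in
    [/\ zero_normal = circle (r P t0) r_PN,
        zero_tangential = circle (r P t0) r_PT,
        [/\ zero_normal (r P t0), zero_tangential (r P t0),
            zero_normal (r N t0) & zero_tangential (r T t0)],
        r_PN = (Omega_r w k t0)^-1 *: p /\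
        r_PT = (Omega_t w k t0)^-1 *: tilde p
      & dot r_PN r_PT = 0]) /\
  (forall A : plane R,
    [/\ accel_via r w k P t0 A = p,
        zero_normal = normal_circle_via r w k P t0 A
      & zero_tangential = tangential_circle_via r w k P t0 A]) /\
  (forall A B : plane R,
    normal_circle_via r w k P t0 A = normal_circle_via r w k P t0 B /\
    tangential_circle_via r w k P t0 A = tangential_circle_via r w k P t0 B).
Proof.
move=> p zero_normal zero_tangential.
case: k => [//|n] in k_gt1 r_diff w_diff Or_neq0 Ot_neq0 p zero_normal
  zero_tangential *.
have rt0 Q : derivable (r Q) t0 1 by apply: (r_diff Q 0%N).
have accelE A B := accelB openI motion A B r_diff w_diff (leqnn n.+1) It0.
have aQ Q : accel r n.+1 Q t0 = p - Omega_r w n.+1 t0 *: (r Q t0 - r P t0)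
    + Omega_t w n.+1 t0 *: tilde (r Q t0 - r P t0).
  by rewrite -addrA -scaleNr -accelE addrC subrK.
have vQ Q : velocity r Q t0 = w t0 *: tilde (r Q t0 - r P t0).
  by rewrite -(velocityB motion) // poleP subr0.
have onto q : exists Q, r Q t0 = q := direct_isometry_surj q (motion t0 It0).1.
(* Cancels the common factor [w t0] of both locus equations. *)
have wmul0 z : (w t0 * z = 0) = (z = 0).
  apply/propext; split=> [/eqP|->]; last by rewrite mulr0.
  by rewrite mulf_eq0 (negPf w_neq0) => /eqP.
have zn : zero_normal = circle (r P t0) ((Omega_r w n.+1 t0)^-1 *: p).
  apply/seteqP; split=> [_ [Q + <-]|q].
    by rewrite mem_circle_scale // /= /no_normal vQ aQ dot_normal wmul0.
  (* The locus fills the whole circle because each [q] on it is the position of a body point. *)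
  have [Q <-] := onto q; rewrite mem_circle_scale // => nQ.
  by exists Q => //=; rewrite /no_normal vQ aQ dot_normal wmul0.
have zt : zero_tangential =
    circle (r P t0) ((Omega_t w n.+1 t0)^-1 *: tilde p).
  apply/seteqP; split=> [_ [Q + <-]|q].
    by rewrite mem_circle_scale // /= /no_tangential vQ aQ dot_tangential wmul0.
  have [Q <-] := onto q; rewrite mem_circle_scale // => nQ.
  by exists Q => //=; rewrite /no_tangential vQ aQ dot_tangential wmul0.
(* The source of the invariance: the vector [p] comes out the same from every [A]. *)
have viaE A : accel_via r w n.+1 P t0 A = p.
  by rewrite /accel_via -addrA -scaleNr -accelE addrC subrK.
split; last first.
  split=> [A|A B]; rewrite /normal_circle_via /tangential_circle_via !viaE //.
(* [N] and [T] are the body points found at the ends of the diameters. *)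
have [N rN] := onto (r P t0 + (Omega_r w n.+1 t0)^-1 *: p).
have [T rT] := onto (r P t0 + (Omega_t w n.+1 t0)^-1 *: tilde p).
exists N, T => r_PN r_PT.
have PN : r_PN = (Omega_r w n.+1 t0)^-1 *: p by rewrite /r_PN rN addrC addKr.
have PT : r_PT = (Omega_t w n.+1 t0)^-1 *: tilde p.
  by rewrite /r_PT rT addrC addKr.
split; rewrite ?PN ?PT //.
  rewrite zn zt rN rT; split; [exact: circle_start|exact: circle_start|
    exact: circle_opposite|exact: circle_opposite].
(* Perpendicularity: the diameters are multiples of [p] and [tilde p]. *)
by rewrite !(dotE, tilde0, tilde1, mxE); ring.
Qed.
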